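(* Let $X$ be an infinite-dimensional complex Banach space, $\lambda\in\mathbb{C}$, $T\in L(X)$, $d\in\mathbb{N}_0$, and let $T-\lambda I$ have TUD for $n\ge d$. Then the following statements are equivalent: (1) $\sigma_{\Phi_-}(T)$ does not cluster at $\lambda$; (2) $\lambda$ is not an interior point of $\sigma_{\Phi_-}(T)$; (3) $\sigma_{RD}^e(T)$ does not cluster at $\lambda$; (4) $\lambda$ is not an interior point of $\sigma_{RD}^e(T)$; (5) $\sigma_{dsc}^e(T)$ does not cluster at $\lambda$; (6) $\lambda$ is not an interior point of $\sigma_{dsc}^e(T)$; (7) $\delta_e(T-\lambda I)<\infty$. In particular, if $T-\lambda I$ is quasi-Fredholm, then the statements (1)-(7) are equivalent to the following statement: (8) $T-\lambda I$ is right essentially Drazin invertible.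
   Context: $L(X)$ is the algebra of bounded linear operators on $X$; $N(T)$, $R(T)$ are the null space and range; $\mathbb{N}_0=\{0,1,2,\dots\}$. $T$ is lower semi-Fredholm if $\operatorname{codim}R(T)<\infty$; $\sigma_{\Phi_-}(T)$ is the set of $\mu\in\mathbb{C}$ such that $T-\mu I$ is not lower semi-Fredholm. The essential descent is $\delta_e(T)=\inf\{n\in\mathbb{N}_0:\dim R(T^n)/R(T^{n+1})<\infty\}$ ($\inf\emptyset=\infty$); $\sigma_{dsc}^e(T)=\{\mu\in\mathbb{C}:\delta_e(T-\mu I)=\infty\}$. $T$ is right essentially Drazin invertible if $\delta_e(T)<\infty$ and $R(T^{\delta_e(T)})$ is closed; $\sigma_{RD}^e(T)$ is the set of $\mu\in\mathbb{C}$ such that $T-\mu I$ is not right essentially Drazin invertible. Let $k_n(T)=\dim (R(T^n)\cap N(T))/(R(T^{n+1})\cap N(T))$. $T$ is quasi-Fredholm if there is $m\in\mathbb{N}_0$ such that $k_n(T)=0$ for all $n\ge m$ and $R(T^{m+1})$ is closed. The operator range topology on $R(T^d)$ is given by the norm $\|y\|_d=\inf\{\|x\|:x\in X,\ y=T^dx\}$. $T$ has topological uniform descent (TUD) for $n\ge d$ if $k_n(T)=0$ for all $n\ge d$ and $R(T^n)$ is closed in the operator range topology of $R(T^d)$ for all $n\ge d$. A set $K\subset\mathbb{C}$ does not cluster at $\lambda$ if $\lambda$ is not an accumulation point of $K$; interior is taken in $\mathbb{C}$. *)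

(* Defs.v *)
From mathcomp Require Import all_boot all_order all_algebra.
From mathcomp Require Import complex.
From mathcomp Require Import all_classical all_reals all_analysis.
Set Implicit Arguments.
Unset Strict Implicit.
Unset Printing Implicit Defensive.
Import Order.TTheory GRing.Theory Num.Theory numFieldNormedType.Exports.
Local Open Scope classical_set_scope.
Local Open Scope ring_scope.
Local Open Scope complex_scope.

(* Numerical invariants that may be infinite take values in \bar R. *)
Definition inf_nat (R : realType) (P : set nat) : \bar R :=
  ereal_inf [set n%:R%:E | n in P].

(* For subspaces W `<=` U, the classes of e_0, ..., e_(n-1) form a basis of
   the quotient U / W. *)
Definition quotient_basis (R : realType) (X : lmodType R[i]) (U W : set X)
    (n : nat) (e : 'I_n -> X) : Prop :=
  [/\ forall i, U (e i),
      forall c : 'I_n -> R[i], W (\sum_i c i *: e i) -> forall i, c i = 0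
    & forall u, U u -> exists c : 'I_n -> R[i], W (u - \sum_i c i *: e i)].

(* All finite bases have the same size; there is none, and the infimum is
   +oo, exactly when the quotient is infinite-dimensional. *)
Definition quotient_dim (R : realType) (X : lmodType R[i]) (U W : set X) :
    \bar R :=
  inf_nat R [set n | exists e : 'I_n -> X, quotient_basis U W e].

Definition infinite_dimensional (R : realType) (X : lmodType R[i]) : Prop :=
  quotient_dim [set: X] [set 0] = +oo%E.

Section OperatorNotions.
Context {R : realType} {X : normedModType R[i]}.
Implicit Types (T : X -> X) (n d : nat) (mu : R[i]).

Definition bounded_operator T : Prop :=
  exists M : R, forall x, `|T x| <= M%:C * `|x|.

Definition sub_scalar T mu : X -> X := fun x => T x - mu *: x.

Definition range_pow T n : set X := range (iter n T).

Definition null_space T : set X := T @^-1` [set 0].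

Definition lower_semi_Fredholm T : Prop :=
  (quotient_dim [set: X] (range T) < +oo)%E.

Definition essential_descent T : \bar R :=
  inf_nat R
    [set n | (quotient_dim (range_pow T n) (range_pow T n.+1) < +oo)%E].

Definition right_essentially_Drazin T : Prop :=
  exists2 n, essential_descent T = n%:R%:E & closed (range_pow T n).

(* A plain R[i] carries no canonical topology in the library: R[i]^o is the
   same type with the topology of the modulus. *)
Definition spectrum_lower_semi_Fredholm T : set R[i]^o :=
  [set mu | ~ lower_semi_Fredholm (sub_scalar T mu)].

Definition spectrum_right_essentially_Drazin T : set R[i]^o :=
  [set mu | ~ right_essentially_Drazin (sub_scalar T mu)].

Definition spectrum_essential_descent T : set R[i]^o :=
  [set mu | essential_descent (sub_scalar T mu) = +oo%E].

Definition descent_defect T n : \bar R :=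
  quotient_dim (range_pow T n `&` null_space T)
               (range_pow T n.+1 `&` null_space T).

Definition quasi_Fredholm T : Prop :=
  exists2 m, forall n, (m <= n)%N -> descent_defect T n = 0%E
           & closed (range_pow T m.+1).

(* The norm of X takes its values in R[i], hence the real part. *)
Definition range_norm T d (y : X) : R :=
  inf [set complex.Re `|x| | x in [set x | y = iter d T x]].

(* A is closed in R(T^d) for range_norm: it contains its adherent points. *)
Definition range_closed T d (A : set X) : Prop :=
  forall y, range_pow T d y ->
    (forall e : R, 0 < e -> exists2 z, A z & range_norm T d (y - z) < e) ->
  A y.

Definition topological_uniform_descent T d : Prop :=
  forall n, (d <= n)%N ->
    descent_defect T n = 0%E /\ range_closed T d (range_pow T n).

End OperatorNotions.

(* Main.v *)
Require Import Defs.
From HB Require Import structures.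
From mathcomp Require Import all_boot all_order all_algebra.
From mathcomp Require Import complex.
From mathcomp Require Import all_classical all_reals all_analysis.
From mathcomp Require Import ring lra.
Set Implicit Arguments.
Unset Strict Implicit.
Unset Printing Implicit Defensive.
Import Order.TTheory GRing.Theory Num.Theory numFieldNormedType.Exports.
Local Open Scope classical_set_scope.
Local Open Scope ring_scope.
Local Open Scope complex_scope.

(** Write S for T - lambda, so that T - mu = S - nu with nu = mu - lambda.
    A lower semi-Fredholm operator is right essentially Drazin invertible, and
    the latter has finite essential descent, so the three spectra are nested.
    All the conditions on them are therefore equivalent to finite essential
    descent of S once two facts are known: finite essential descent of S makes
    S - nu lower semi-Fredholm for all small nonzero nu, and, under uniform
    descent, finite essential descent of a single S - nu with nu small and
    nonzero gives it to S.

    Everything is read in X modulo a closed subspace N, most often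
    N = N(S^n): applying S^n identifies X / N(S^n) with R(S^n), its quotient
    norm with the operator range norm, and R(S^n) / R(S^(n+1)) with
    X / (R(S) + N(S^n)).  The finiteness of the essential descent thus says
    that some R(S) + N(S^n) has finite codimension.

    First fact (Fredholm_shift_of_descent).  Let X = R(S) + N(S^n) + F with F
    finite-dimensional.  The subspace N(S^n) + F is closed, so by the open
    mapping theorem X = R(S) + N(S^n) + F survives a small perturbation of S;
    and N(S^n) lies in R(S - nu) when nu is nonzero.

    Second fact (essential_descent_of_shift).  Let N = N(S^d) and let M be the
    set of the x with S^d x in every R(S^n).  Uniform descent makes R(S) + N
    closed and S surjective modulo N from M onto M, with every x such that
    S x is in N belonging to M.  Solving (S - nu) x = m by a geometric series
    gives that M lies in R(S - nu) + N for small nu; as the generalized kernel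
    of S - nu lies in M, finite essential descent of S - nu makes R(S - nu) + N
    of finite codimension.  Finally S is bounded below modulo M, which puts
    R(S - nu) + N, up to a small relative error, inside R(S) + N.  A closed
    subspace that nearly contains a subspace of finite codimension has finite
    codimension itself, because the unit ball is totally bounded modulo the
    latter (cofinite_gap).  The bound on nu depends on S alone, which is what
    an accumulation argument requires.

    For a quasi-Fredholm S the open mapping theorem propagates closedness from
    R(S^n) to R(S^(n+1)) along the vanishing of the k_n.  With p the essential
    descent, R(S^p) is a finite-dimensional extension of every R(S^(p+k)), hence
    of a closed range, hence closed.

    The analytic engine is a single iteration, successive_approximation, used
    for the open mapping theorem, for both perturbation arguments and for the
    criterion of density by approximation with relative error one half. *)

(** * The norm as a real number *)

Section RealNorm.
Context {R : realType}.

(** The norm of a space over R[i] takes its values in R[i], where the order is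
    partial; all estimates are made on its real part instead. *)
Definition nrm (V : normedZmodType R[i]) (x : V) : R := complex.Re `|x|.

Section Zmodule.
Context {V : normedZmodType R[i]}.
Implicit Types x y : V.

Lemma nrmE x : `|x| = (nrm x)%:C.
Proof.
by rewrite /nrm; move: (normr_ge0 x); case: `|x| => a b; rewrite lecE /= => /andP[/eqP-> _].
Qed.

Lemma nrm_ge0 x : 0 <= nrm x.
Proof. by rewrite -ler0c -nrmE. Qed.

Lemma nrmD x y : nrm (x + y) <= nrm x + nrm y.
Proof. by rewrite -lecR rmorphD /= -!nrmE ler_normD. Qed.

Lemma nrmN x : nrm (- x) = nrm x.
Proof. by rewrite /nrm normrN. Qed.

Lemma nrmB x y : nrm (x - y) <= nrm x + nrm y.
Proof. by rewrite -(nrmN y) nrmD. Qed.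

Lemma nrmC x y : nrm (x - y) = nrm (y - x).
Proof. by rewrite -nrmN opprB. Qed.

Lemma nrm_split z x y : nrm (x - y) <= nrm (x - z) + nrm (z - y).
Proof. by rewrite -{1}(subrK z x) -addrA nrmD. Qed.

Lemma nrm0 : nrm (0 : V) = 0.
Proof. by rewrite /nrm normr0. Qed.

Lemma nrm_eq0 x : nrm x = 0 -> x = 0.
Proof. by move=> x0; apply/normr0_eq0; rewrite nrmE x0. Qed.

Lemma nrm_gt0 x : x <> 0 -> 0 < nrm x.
Proof.
by move=> x0; rewrite lt_neqAle nrm_ge0 andbT eq_sym; apply/eqP => /nrm_eq0.
Qed.

End Zmodule.

Lemma nrm_real (a : R) : 0 <= a -> nrm (a%:C : R[i]) = a.
Proof. by move=> a0; rewrite /nrm ger0_norm // ler0c. Qed.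

Lemma nrmV (a : R[i]) : nrm a^-1 = (nrm a)^-1.
Proof. by apply: complexI; rewrite fmorphV /= -!nrmE normfV. Qed.

Lemma nrm_ReIm (a : R[i]) :
  [/\ `|complex.Re a| <= nrm a, `|complex.Im a| <= nrm a
    & nrm a <= `|complex.Re a| + `|complex.Im a|].
Proof.
have N : nrm a = Num.sqrt (complex.Re a ^+ 2 + complex.Im a ^+ 2).
  by rewrite /nrm normc_def.
rewrite N; split.
- by rewrite -sqrtr_sqr ler_wsqrtr // lerDl sqr_ge0.
- by rewrite -sqrtr_sqr ler_wsqrtr // lerDr sqr_ge0.
- rewrite -[leRHS]ger0_norm ?addr_ge0 // -sqrtr_sqr ler_wsqrtr //.
  rewrite -(real_normK (num_real (complex.Re a))) -(real_normK (num_real (complex.Im a))).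
  have := normr_ge0 (complex.Re a); have := normr_ge0 (complex.Im a); nra.
Qed.

Section Topology.
Context {X : normedModType R[i]}.
Implicit Types (x y : X) (A : set X).

Lemma nrmZ (a : R[i]) x : nrm (a *: x) = nrm a * nrm x.
Proof. by apply: complexI; rewrite rmorphM /= -!nrmE normrZ. Qed.

Lemma nbhs_nrm x A :
  nbhs x A <-> exists2 e, 0 < e & forall y, nrm (x - y) < e -> A y.
Proof.
split.
  move=> /nbhs_normP[e /= e0 eA]; have eE : e = (complex.Re e)%:C.
    by rewrite RRe_real// gtr0_real.
  exists (complex.Re e); first by rewrite -ltcR -eE.
  by move=> y xy; apply: eA; rewrite /= nrmE eE ltcR.
move=> [e e0 eA]; apply/nbhs_normP; exists e%:C => /=; first by rewrite ltcR.
by move=> y /=; rewrite nrmE ltcR; exact: eA.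
Qed.

Lemma closure_nrm A x :
  closure A x <-> forall e, 0 < e -> exists2 z, A z & nrm (x - z) < e.
Proof.
split=> [clA e e0|H B /nbhs_nrm[e e0 eB]].
  have [z [Az xz]] : A `&` [set y | nrm (x - y) < e] !=set0.
    by apply: clA; apply/nbhs_nrm; exists e.
  by exists z.
by have [z Az xz] := H _ e0; exists z; split => //; exact: eB.
Qed.

Lemma closed_nrm A : closed A <-> closure A `<=` A.
Proof.
split=> [/closure_id <- //|H]; rewrite closure_id; apply/seteqP; split => //.
exact: subset_closure.
Qed.

End Topology.

Definition converges (V : normedZmodType R[i]) (u : nat -> V) (l : V) :=
  forall e : R, 0 < e -> exists N, forall n, (N <= n)%N -> nrm (u n - l) < e.

Definition is_cauchy (V : normedZmodType R[i]) (u : nat -> V) :=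
  forall e : R, 0 < e ->
    exists N, forall m n, (N <= m)%N -> (N <= n)%N -> nrm (u m - u n) < e.

Lemma cauchy_converges (X : completeNormedModType R[i]) (u : nat -> X) :
  is_cauchy u -> exists l, converges u l.
Proof.
move=> cu; have : cvg (u @ \oo).
  apply/cauchy_cvgP/cauchy_exP => e e0.
  have eE : e = (complex.Re e)%:C by rewrite RRe_real// gtr0_real.
  have [|N NP] := cu (complex.Re e); first by rewrite -ltcR -eE.
  exists (u N); exists N => // n /= Nn.
  by rewrite -ball_normE /= nrmE eE ltcR; apply: NP.
move=> /cvg_ex[l /cvgrPdist_lt ul]; exists l => e e0.
have [|N _ NP] := ul e%:C; first by rewrite ltcR.
by exists N => n Nn; have := NP n Nn; rewrite /= nrmE ltcR nrmC.
Qed.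

(** Completeness of the real line, applied to the real and imaginary parts. *)
Lemma cauchy_converges_complex (c : nat -> R[i]) :
  is_cauchy c -> exists l, converges c l.
Proof.
move=> cc; have part (f : R[i] -> R) : (forall a b, f (a - b) = f a - f b) ->
    (forall a, `|f a| <= nrm a) -> exists l, forall e, 0 < e ->
      exists N, forall n, (N <= n)%N -> `|f (c n) - l| < e.
  move=> fB fle; have : cvg ((f \o c) @ \oo).
    apply/cauchy_cvgP/cauchy_exP => e e0; have [N NP] := cc e e0.
    exists (f (c N)); exists N => // n /= Nn; rewrite -ball_normE /= -fB.
    by apply: le_lt_trans (fle _) _; apply: NP.
  move=> /cvg_ex[l /cvgrPdist_lt ul]; exists l => e e0.
  have [N _ NP] := ul e e0.
  by exists N => n Nn; have := NP n Nn; rewrite /= distrC.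
have [|a|x xP] := part (@complex.Re R); first by case=> [? ?] [].
  by have [] := nrm_ReIm a.
have [|a|y yP] := part (@complex.Im R); first by case=> [? ?] [].
  by have [] := nrm_ReIm a.
exists (x +i* y) => e e0; have e2 : 0 < e / 2 by rewrite divr_gt0.
have [N NP] := xP _ e2; have [M MP] := yP _ e2.
exists (maxn N M) => n; rewrite geq_max => /andP[/NP Hx /MP Hy].
have [_ _] := nrm_ReIm (c n - (x +i* y)).
by case: (c n) Hx Hy => a b /=; lra.
Qed.

End RealNorm.

(** * Subspaces and finite-dimensional extensions *)

Section Subspaces.
Context {R : realType} {X : normedModType R[i]}.
Implicit Types (W N V : set X) (S : {linear X -> X}).

Definition subspace W : Prop :=
  [/\ W 0, forall x y, W x -> W y -> W (x + y)
    & forall c x, W x -> W (c *: x)].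

Lemma subspace0 W : subspace W -> W 0. Proof. by case. Qed.

Lemma subspaceD W x y : subspace W -> W x -> W y -> W (x + y).
Proof. by case=> _ + _; apply. Qed.

Lemma subspaceZ W c x : subspace W -> W x -> W (c *: x).
Proof. by case=> _ _; apply. Qed.

Lemma subspaceN W x : subspace W -> W x -> W (- x).
Proof. by move=> sW Wx; rewrite -scaleN1r; apply: subspaceZ. Qed.

Lemma subspaceB W x y : subspace W -> W x -> W y -> W (x - y).
Proof. by move=> sW Wx Wy; apply: subspaceD => //; apply: subspaceN. Qed.

Definition add_line W (e : X) : set X := [set x | exists c, W (x - c *: e)].

(** The sum of W and the span of a finite sequence, built one line at a time so
    that facts about it follow from facts about add_line by induction. *)
Definition add_span W (s : seq X) : set X := foldr (fun e U => add_line U e) W s.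

(** The subspace R(S) + W. *)
Definition add_range S W : set X := [set y | exists x, W (y - S x)].

Lemma subspace_add_line W e : subspace W -> subspace (add_line W e).
Proof.
move=> sW; split.
- by exists 0; rewrite scale0r subrr; apply: subspace0.
- move=> x y [c Wx] [c' Wy]; exists (c + c').
  by rewrite scalerDl opprD addrACA; apply: subspaceD.
- move=> a x [c Wx]; exists (a * c).
  by rewrite -scalerA -scalerBr; apply: subspaceZ.
Qed.

Lemma subspace_add_span W s : subspace W -> subspace (add_span W s).
Proof. by move=> sW; elim: s => //= e s; exact: subspace_add_line. Qed.

Lemma subspace_add_range S W : subspace W -> subspace (add_range S W).
Proof.
move=> sW; split.
- by exists 0; rewrite linear0 subrr; apply: subspace0.
- move=> x y [u Wx] [v Wy]; exists (u + v).
  by rewrite linearD opprD addrACA; apply: subspaceD.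
- move=> a x [u Wx]; exists (a *: u).
  by rewrite linearZ -scalerBr; apply: subspaceZ.
Qed.

Lemma sub_add_span W s : W `<=` add_span W s.
Proof.
by elim: s => [//|e s IH] x /IH Wx; exists 0; rewrite scale0r subr0.
Qed.

Lemma mem_add_span W s x : subspace W -> x \in s -> add_span W s x.
Proof.
move=> sW; elim: s => [//|e s IH]; rewrite in_cons => /predU1P[->|/IH Wx].
  exists 1; rewrite scale1r subrr.
  exact: subspace0 (subspace_add_span _ sW).
by exists 0; rewrite scale0r subr0.
Qed.

Lemma add_span_mono W V s : W `<=` V -> add_span W s `<=` add_span V s.
Proof. by move=> WV; elim: s => [//|e s IH] x [c /IH Wx]; exists c. Qed.

Lemma add_spanP W s x :
  add_span W s x <->
  exists c : 'I_(size s) -> R[i], W (x - \sum_i c i *: s`_i).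
Proof.
elim: s x => [|e s IH] x /=.
  split=> [Wx|[c]]; last by rewrite big_ord0 subr0.
  by exists (fun=> 0); rewrite big_ord0 subr0.
split=> [[a /IH[c Wx]]|[c Wx]].
  exists (fun i => if unlift ord0 i is Some j then c j else a).
  rewrite big_ord_recl unlift_none /= opprD addrA.
  by under eq_bigr => i _ do rewrite liftK.
exists (c ord0); apply/IH; exists (fun j => c (lift ord0 j)).
by move: Wx; rewrite big_ord_recl /= opprD addrA.
Qed.

Lemma add_range_span S W s x :
  add_span (add_range S W) s x <-> add_range S (add_span W s) x.
Proof.
elim: s x => [//|e s IH] x /=; split.
  move=> [c /IH[u Wx]]; exists u; exists c.
  by rewrite addrAC.
move=> [u [c Wx]]; exists c; apply/IH; exists u.
by rewrite addrAC.
Qed.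

End Subspaces.

(** * Dimensions of quotients *)

Section Dimension.
Context {R : realType}.

(** The naturals are well ordered, so the infimum is attained. *)
Lemma inf_nat_min (P : set nat) : (inf_nat R P < +oo)%E ->
  exists2 n, P n & inf_nat R P = n%:R%:E.
Proof.
move=> Pfin; have Pn : exists n, `[< P n >].
  by have [_ [n Pn _] _] := ereal_inf_lt Pfin; exists n; exact/asboolP.
case: (ex_minnP Pn) => n /asboolP Pn' nmin; exists n => //.
apply/eqP; rewrite eq_le; apply/andP; split.
  by apply: ereal_inf_lbound; exists n.
apply: le_ereal_inf_tmp => _ [m /= Pm <-]; rewrite lee_fin ler_nat.
by apply: nmin; exact/asboolP.
Qed.

Lemma inf_nat_fin (P : set nat) n : P n -> (inf_nat R P < +oo)%E.
Proof.
move=> Pn; apply: (@le_lt_trans _ _ n%:R%:E); last by rewrite ltry.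
by apply: ereal_inf_lbound; exists n.
Qed.

Lemma inf_nat0 (P : set nat) : P 0%N -> inf_nat R P = 0%E.
Proof.
move=> P0; apply/eqP; rewrite eq_le; apply/andP; split.
  by apply: ereal_inf_lbound; exists 0%N.
by apply: le_ereal_inf_tmp => _ [m _ <-]; rewrite lee_fin.
Qed.

Context {X : normedModType R[i]}.
Implicit Types U W : set X.

(** A generating family of least size modulo W is a basis of U / W: a nontrivial
    relation would let one generator be eliminated. *)
Lemma quotient_dim_fin U W : subspace U -> subspace W ->
  (quotient_dim U W < +oo)%E <->
  exists2 s : seq X, {in s, forall x, U x} & U `<=` add_span W s.
Proof.
move=> sU sW; split.
  move=> /inf_nat_min[n [e [Ue _ eU]] _]; exists [seq e i | i <- enum 'I_n].
    by move=> _ /mapP[i _ ->].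
  move=> u /eU[c Wu]; have sz : size [seq e i | i <- enum 'I_n] = n.
    by rewrite size_map size_enum_ord.
  apply/add_spanP; exists (fun i => c (cast_ord sz i)).
  suff -> : \sum_(i < size [seq e i | i <- enum 'I_n])
     c (cast_ord sz i) *: [seq e i | i <- enum 'I_n]`_i = \sum_i c i *: e i by [].
  rewrite (reindex (cast_ord (esym sz))) /=; last first.
    by apply: onW_bij; exists (cast_ord sz); [exact: cast_ordKV|exact: cast_ordK].
  apply: eq_bigr => i _; rewrite cast_ordKV; congr (_ *: _).
  by rewrite (nth_map i) ?size_enum_ord ?nth_ord_enum.
move=> [s Us UW].
pose spans n := exists e : 'I_n -> X, (forall i, U (e i)) /\
  forall u, U u -> exists c : 'I_n -> R[i], W (u - \sum_i c i *: e i).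
have Pn : exists n, `[< spans n >].
  exists (size s); apply/asboolP; exists (fun i => s`_i); split.
    by move=> i; apply: Us; apply: mem_nth.
  by move=> u /UW /add_spanP.
case: (ex_minnP Pn) => n /asboolP[e [Ue eU]] nmin.
apply: (@inf_nat_fin _ n); exists e; split => // c Wc i.
apply/eqP; apply: contrapT => /negP ci0.
case: n e Ue eU nmin c Wc i ci0 => [|n] e Ue eU nmin c Wc i ci0.
  by case: i ci0.
suff : (n.+1 <= n)%N by rewrite ltnn.
apply: nmin; apply/asboolP; exists (fun j => e (lift i j)); split => // u Uu.
have [b Wu] := eU u Uu; exists (fun j => b (lift i j) - b i / c i * c (lift i j)).
have sum_lift (f : 'I_n.+1 -> X) : \sum_j f j = f i + \sum_j f (lift i j).
  rewrite (bigD1 i) //=; congr (_ + _).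
  rewrite (reindex_omap (op := +%R) (lift i) (unlift i)) /=; last first.
    by move=> j ji; case: unliftP ji => [k ->|->]; rewrite ?eqxx.
  by apply: eq_bigl => j; rewrite liftK eqxx eq_sym neq_lift.
suff -> : u - \sum_j (b (lift i j) - b i / c i * c (lift i j)) *: e (lift i j) =
   (u - \sum_j b j *: e j) + (b i / c i) *: \sum_j c j *: e j.
  by apply: subspaceD => //; apply: subspaceZ.
rewrite [\sum_j b j *: _]sum_lift [\sum_j c j *: _]sum_lift scalerDr scalerA.
rewrite divfK //.
(* Both sides differ only in the i-th term, which the multiple of the relation
   cancels. *)
have cancel (A B C : X) : u - (A + B) + (A + C) = u - B + C.
  by rewrite opprD (addrC (- A)) !addrA subrK.
rewrite cancel -addrA; congr (_ + _); rewrite scaler_sumr -!sumrN -big_split.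
apply: eq_bigr => j _ /=.
by rewrite scalerBl opprB addrC scalerA.
Qed.

Lemma quotient_dim0 U W : quotient_dim U W = 0%E -> U `<=` W.
Proof.
move=> q0; have qfin : (quotient_dim U W < +oo)%E by rewrite q0 ltry.
have [n [e [_ _ eU]]] := inf_nat_min qfin.
rewrite -/(quotient_dim U W) q0 => -[/esym/eqP]; rewrite pnatr_eq0 => /eqP n0.
move=> u Uu; have [c] := eU u Uu; move: e eU c; rewrite n0 => e _ c.
by rewrite big_ord0 subr0.
Qed.

End Dimension.

(** * Successive approximation and the open mapping theorem *)

Section Banach.
Context {R : realType} {X : completeNormedModType R[i]}.
Implicit Types (W V P : set X) (S B : {linear X -> X}).

Lemma small_pow2 (a e : R) : 0 < e ->
  exists N, forall n, (N <= n)%N -> a / 2 ^+ n < e.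
Proof.
move=> e0; exists (Num.truncn `|a / e|).+1 => n Nn.
rewrite ltr_pdivrMr ?exprn_gt0 // mulrC -ltr_pdivrMr //.
apply: le_lt_trans (ler_norm _) _; apply: lt_le_trans (truncnS_gt _) _.
rewrite -natrX ler_nat (leq_trans Nn) //.
by apply: ltnW; apply: ltn_expl.
Qed.

Lemma bounded_nrm (T : X -> X) : bounded_operator T ->
  exists2 M, 0 < M & forall x, nrm (T x) <= M * nrm x.
Proof.
move=> [M TM]; exists (`|M| + 1); first by rewrite ltr_wpDl.
move=> x; have := TM x; rewrite !nrmE -rmorphM lecR => /le_trans; apply.
by rewrite ler_wpM2r ?nrm_ge0 // (le_trans (ler_norm _)) // lerDl.
Qed.

Lemma converges_nrm_le (u : nat -> X) l x r N : converges u l ->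
  (forall n, (N <= n)%N -> nrm (u n - x) <= r) -> nrm (l - x) <= r.
Proof.
move=> ul ur; apply/ler_addgt0Pr => e e0; have [M MP] := ul e e0.
have Hu := MP (maxn N M) (leq_maxr _ _).
have Hx := ur (maxn N M) (leq_maxl _ _).
have := nrm_split (u (maxn N M)) l x; rewrite (nrmC l (u _)); lra.
Qed.

Lemma cauchy_of_tails (u : nat -> X) (r : nat -> R) :
  (forall e, 0 < e -> exists N, r N < e) ->
  (forall m n, (n <= m)%N -> nrm (u m - u n) <= r n) -> is_cauchy u.
Proof.
move=> r0 ur e e0; have [N rN] := r0 (e / 2) (divr_gt0 e0 (ltr0n _ 2)).
exists N => m n Nm Nn; have := nrm_split (u N) (u m) (u n).
have := ur m N Nm; have := ur n N Nn; rewrite (nrmC (u N) (u n)); lra.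
Qed.

(** If every equation B x = y modulo N with y in P can be solved up to an error
    that stays in P and halves the norm, then iterating on the error and summing
    the corrections solves it exactly.  The sum converges because X is complete,
    and the remaining error vanishes modulo N because N is closed. *)
Lemma successive_approximation B (N : set X) P (K : R) : bounded_operator B ->
  closed N -> subspace N -> 0 <= K ->
  (forall y, P y -> exists x y',
    [/\ nrm x <= K * nrm y, N (y - B x - y'), P y' & nrm y' <= nrm y / 2]) ->
  forall y, P y -> exists2 x, nrm x <= 2 * K * nrm y & N (y - B x).
Proof.
move=> bB clN sN K0 step y Py.
have /choice[F FP] : forall z, exists p : X * X, P z ->
    [/\ nrm p.1 <= K * nrm z, N (z - B p.1 - p.2), P p.2 & nrm p.2 <= nrm z / 2].
  move=> z; have [Pz|nPz] := pselect (P z); last by exists (0, 0).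
  by have [x [y' ?]] := step z Pz; exists (x, y').
pose r := fix r n := if n is m.+1 then (F (r m)).2 else y.
pose w n := \sum_(j < n) (F (r j)).1.
have Pr n : P (r n) by elim: n => [//|n /FP[]].
have r_le n : nrm (r n) <= nrm y / 2 ^+ n.
  elim: n => [|n IH] /=; first by rewrite expr0 divr1.
  have [_ _ _] := FP _ (Pr n); rewrite exprSr invfM mulrA.
  by move: IH; set a := _ / 2 ^+ n; lra.
have wS n : w n.+1 = w n + (F (r n)).1 by rewrite /w big_ord_recr.
have Nw n : N (y - B (w n) - r n).
  elim: n => [|n IH]; first by rewrite /w big_ord0 linear0 subr0 subrr; case: sN.
  have [_ Nn _ _] := FP _ (Pr n); rewrite wS linearD /=.
  suff -> : y - (B (w n) + B (F (r n)).1) - (F (r n)).2 =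
    (y - B (w n) - r n) + (r n - B (F (r n)).1 - (F (r n)).2) by apply: subspaceD.
  by rewrite opprD !addrA subrK.
pose c := 2 * K * nrm y.
have w_tail m n : (n <= m)%N -> nrm (w m - w n) <= c / 2 ^+ n - c / 2 ^+ m.
  elim: m => [|m IH]; first by rewrite leqn0 => /eqP ->; rewrite !subrr nrm0.
  rewrite leq_eqVlt => /predU1P[->|/IH {}IH]; first by rewrite !subrr nrm0.
  have [xn _ _ _] := FP _ (Pr m).
  have := nrmD (w m - w n) (F (r m)).1; rewrite addrAC -wS => /le_trans; apply.
  have := ler_wpM2l K0 (r_le m); rewrite exprSr invfM.
  have -> : K * (nrm y / 2 ^+ m) = c / 2 ^+ m / 2.
    by rewrite /c; move: (2 ^+ m)^-1 => q; field.
  by move: IH xn; rewrite mulrA; set a := c / 2 ^+ m; lra.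
have c0 : 0 <= c by rewrite !mulr_ge0 ?nrm_ge0.
have w_tail' m n : (n <= m)%N -> nrm (w m - w n) <= c / 2 ^+ n.
  move=> /w_tail /le_trans; apply; rewrite lerBlDr lerDl.
  by rewrite divr_ge0 // exprn_ge0.
have [l wl] : exists l, converges w l.
  apply/cauchy_converges/(cauchy_of_tails _ w_tail') => e /(small_pow2 c)[M MP].
  by exists M; apply: MP.
exists l.
  rewrite -[l]subr0; apply: (converges_nrm_le (N := 0) wl) => n _.
  by have := w_tail' n 0%N (leq0n _); rewrite {2}/w big_ord0 expr0 divr1.
move/closed_nrm: clN; apply; apply/closure_nrm => e e0.
have [M M0 BM] := bounded_nrm bB.
have [n1 n1P] := small_pow2 (nrm y) (divr_gt0 e0 (ltr0n _ 2)).
have [|n2 n2P] := wl (e / 2 / M); first by rewrite !divr_gt0.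
set n := maxn n1 n2; exists (y - B (w n) - r n) => //.
have -> : y - B l - (y - B (w n) - r n) = B (w n - l) + r n.
  rewrite [B (w n - l)]linearB opprB addrCA [LHS]addrC; congr (_ + _).
  by rewrite opprB addrC addrA subrK.
have := nrmD (B (w n - l)) (r n); have := BM (w n - l).
have := n2P n (leq_maxr _ _); rewrite ltr_pdivlMr // mulrC.
have := n1P n (leq_maxl _ _); have := r_le n; lra.
Qed.

(** Otherwise every ball centred in V contains a ball of at most half the radius,
    centred in V, that misses C n; nesting such balls for n = 0, 1, and so on
    yields a limit in V that belongs to no C n. *)
Lemma baire_category V (C : nat -> set X) : closed V -> V !=set0 ->
  (forall v, V v -> exists n, C n v) ->
  exists n v r, [/\ 0 < r, V v & forall u, V u -> nrm (u - v) < r -> closure (C n) u].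
Proof.
move=> clV [v0 Vv0] cover; apply: contrapT => nope.
(* A pair is a ball: its centre and its radius. *)
have refine n (p : X * R) : exists q : X * R, V p.1 -> 0 < p.2 ->
  [/\ V q.1, 0 < q.2, q.2 <= p.2 / 2, nrm (q.1 - p.1) + q.2 <= p.2
    & forall z, C n z -> q.2 < nrm (z - q.1)].
  case: p => v r /=; have [Vv|] := pselect (V v); last by exists (0, 0).
  have [r0|] := pselect (0 < r); last by exists (0, 0).
  have [u [Vu ur nu]] : exists u, [/\ V u, nrm (u - v) < r / 2 & ~ closure (C n) u].
    apply: contrapT => nu; apply: nope; exists n, v, (r / 2); split => //.
      by rewrite divr_gt0.
    by move=> u Vu ur; apply: contrapT => clu; apply: nu; exists u.
  have [e e0 ue] : exists2 e, 0 < e & forall z, C n z -> e <= nrm (z - u).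
    apply: contrapT => ne; apply/nu/closure_nrm => e e0.
    apply: contrapT => nz; apply: ne; exists e => // z Cz.
    by rewrite leNgt; apply/negP => ze; apply: nz; exists z => //; rewrite nrmC.
  exists (u, Num.min (r / 2) (e / 2)) => _ _ /=; split => //.
  - by rewrite lt_min !divr_gt0.
  - by rewrite ge_min lexx.
  - have : Num.min (r / 2) (e / 2) <= r / 2 by rewrite ge_min lexx.
    by move: ur; lra.
  - move=> z /ue; have : Num.min (r / 2) (e / 2) <= e / 2 by rewrite ge_min lexx orbT.
    by move: e0; lra.
have /choice[F FP] : forall np : nat * (X * R), exists q : X * R,
    V np.2.1 -> 0 < np.2.2 -> [/\ V q.1, 0 < q.2, q.2 <= np.2.2 / 2,
      nrm (q.1 - np.2.1) + q.2 <= np.2.2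
      & forall z, C np.1 z -> q.2 < nrm (z - q.1)].
  by case=> n p; apply: refine.
pose b := fix b n := if n is m.+1 then F (m, b m) else (v0, 1 : R).
have Vb n : V (b n).1 /\ 0 < (b n).2.
  by elim: n => [//|n [Vn rn]] /=; have [] := FP (n, b n) Vn rn.
have bS n : [/\ (b n.+1).2 <= (b n).2 / 2,
   nrm ((b n.+1).1 - (b n).1) + (b n.+1).2 <= (b n).2
   & forall z, C n z -> (b n.+1).2 < nrm (z - (b n.+1).1)].
  by have [Vn rn] := Vb n; have [] := FP (n, b n) Vn rn.
have rad n : (b n).2 <= 1 / 2 ^+ n.
  elim: n => [|n IH]; first by rewrite expr0 divr1.
  have [+ _ _] := bS n; rewrite exprSr invfM mulrA.
  by move: IH; set a := _ / 2 ^+ n; lra.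
have nested m n : (n <= m)%N -> nrm ((b m).1 - (b n).1) + (b m).2 <= (b n).2.
  elim: m => [|m IH]; first by rewrite leqn0 => /eqP ->; rewrite subrr nrm0 add0r.
  rewrite leq_eqVlt => /predU1P[->|/IH {}IH]; first by rewrite subrr nrm0 add0r.
  have [_ + _] := bS m.
  by have := nrm_split (b m).1 (b m.+1).1 (b n).1; move: IH; lra.
have tail m n : (n <= m)%N -> nrm ((b m).1 - (b n).1) <= (b n).2.
  by move=> /nested; have [_] := Vb m; lra.
have [l bl] : exists l, converges (fun n => (b n).1) l.
  apply/cauchy_converges/(cauchy_of_tails _ tail) => e /(small_pow2 1)[M MP].
  by exists M; apply: le_lt_trans (rad M) (MP M (leqnn M)).
have Vl : V l.
  move/closed_nrm: clV; apply; apply/closure_nrm => e /bl[n nP].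
  exists (b n).1; first by have [] := Vb n.
  by rewrite nrmC; apply: nP.
have [n Cnl] := cover l Vl; have [_ _ /(_ l Cnl)] := bS n.
have := converges_nrm_le (x := (b n.+1).1) (N := n.+1) bl (fun m => @tail m n.+1).
lra.
Qed.

(** The open mapping theorem for S seen as a map from X onto (R(S) + N) / N.  Some
    closure of the image C n of the ball of radius n contains a ball of
    R(S) + N; differences of points of that ball approximate every y up to half
    its norm, and the approximation is made exact by iteration. *)
Lemma open_mapping S (N : set X) : bounded_operator S -> closed N -> subspace N ->
  closed (add_range S N) ->
  exists2 K, 0 <= K &
    forall y, add_range S N y -> exists2 x, nrm x <= K * nrm y & N (y - S x).
Proof.
move=> bS clN sN clV; pose V := add_range S N.
have sV : subspace V := subspace_add_range S sN.
pose C n : set X := [set y | exists2 x, nrm x <= n%:R & N (y - S x)].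
have [||n [v [r [r0 Vv vr]]]] := @baire_category V C clV.
- by exists 0; apply: subspace0.
- move=> v [x Nx]; exists (Num.truncn (nrm x)).+1; exists x => //.
  exact/ltW/truncnS_gt.
pose K := 4 * n%:R / r.
have K0 : 0 <= K by rewrite divr_ge0 ?mulr_ge0 // ltW.
exists (2 * K); first by rewrite mulr_ge0.
apply: (successive_approximation bS clN sN K0) => y Vy.
have [->|/eqP/nrm_gt0 y0] := eqVneq y 0.
  exists 0, 0; rewrite linear0 !subr0 nrm0 mulr0 mul0r; split => //.
    exact: subspace0.
  exact: subspace0.
(* The vector t y has norm r / 2, so v + t y stays in the ball around v. *)
pose t := r / (2 * nrm y); have t0 : 0 < t by rewrite divr_gt0 ?mulr_gt0.
have tN : nrm (t%:C : R[i]) = t by rewrite nrm_real // ltW.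
have tE : t * nrm y = r / 2 by rewrite /t; field; rewrite gt_eqF.
have tVE : t^-1 = 2 * nrm y / r by rewrite /t invf_div.
have tC0 : t%:C != 0 :> R[i].
  by apply/eqP => t0'; move: tN t0; rewrite t0' nrm0 => <-; rewrite ltxx.
have r8 : 0 < r / 8 by rewrite divr_gt0.
have [z1 [x1 x1n N1] d1] : exists2 z, C n z & nrm (v + t%:C *: y - z) < r / 8.
  have /closure_nrm : closure (C n) (v + t%:C *: y); last by apply.
  apply: vr; first by apply: subspaceD => //; apply: subspaceZ.
  by rewrite addrAC subrr add0r nrmZ tN tE; lra.
have [z2 [x2 x2n N2] d2] : exists2 z, C n z & nrm (v - z) < r / 8.
  have /closure_nrm : closure (C n) v; last by apply.
  by apply: vr => //; rewrite subrr nrm0.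
have Vz : V (z1 - z2).
  by apply: subspaceB => //; [exists x1|exists x2].
exists (t%:C^-1 *: (x1 - x2)), (y - t%:C^-1 *: (z1 - z2)); split.
- rewrite nrmZ nrmV tN tVE.
  have -> : K * nrm y = 2 * nrm y / r * (n%:R + n%:R).
    by rewrite /K; field; rewrite gt_eqF.
  rewrite ler_wpM2l ?divr_ge0 ?mulr_ge0 ?nrm_ge0 ?(ltW r0) //.
  exact: le_trans (nrmB x1 x2) (lerD x1n x2n).
- rewrite linearZ opprB addrC addrA subrK -scalerBr.
  apply: subspaceZ => //.
  suff -> : z1 - z2 - S (x1 - x2) = (z1 - S x1) - (z2 - S x2) by apply: subspaceB.
  by rewrite [S _]linearB !opprB addrACA [RHS]addrACA [- z2 + _]addrC.
- by apply: subspaceB => //; apply: subspaceZ.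
- have -> : y - t%:C^-1 *: (z1 - z2) =
      t%:C^-1 *: ((v + t%:C *: y - z1) - (v - z2)).
    rewrite -[X in X - _](scalerK tC0) -scalerBr; congr (_ *: _).
    by rewrite !opprB [RHS]addrC !addrA subrK [z2 + _]addrC.
  rewrite nrmZ nrmV tN tVE.
  have -> : nrm y / 2 = 2 * nrm y / r * (r / 4) by field; rewrite gt_eqF.
  rewrite ler_wpM2l ?divr_ge0 ?mulr_ge0 ?nrm_ge0 ?(ltW r0) //.
  by apply: le_trans (nrmB _ _) _; move: d1 d2; lra.
Qed.

End Banach.

(** * Finite-codimensional subspaces *)

Section FiniteCodimension.
Context {R : realType} {X : completeNormedModType R[i]}.
Implicit Types (W V : set X) (S : {linear X -> X}) (s : seq X).

(** A vector at distance at least r from W controls its own coefficient. *)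
Lemma dist_line W (e w : X) (c : R[i]) (r : R) : subspace W -> 0 <= r ->
  (forall z, W z -> r <= nrm (e - z)) -> W w -> nrm c * r <= nrm (c *: e + w).
Proof.
move=> sW r0 er Ww; have [->|c0] := eqVneq c 0.
  by rewrite nrm0 mul0r nrm_ge0.
have -> : c *: e + w = c *: (e - (- c^-1) *: w).
  by rewrite scalerBr scalerA mulrN divff // scaleN1r opprK.
by rewrite nrmZ ler_wpM2l ?nrm_ge0 // er //; apply: subspaceZ.
Qed.

Lemma far_from_closure W e : ~ closure W e ->
  exists2 r, 0 < r & forall z, W z -> r <= nrm (e - z).
Proof.
move=> ncl; apply: contrapT => nr; apply/ncl/closure_nrm => r r0.
apply: contrapT => nz; apply: nr; exists r => // z Wz.
by rewrite leNgt; apply/negP => ez; apply: nz; exists z.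
Qed.

(** If e is off the closed subspace W, the coefficients along e of a Cauchy
    sequence of W + Ce are Cauchy, so that both components converge. *)
Lemma closed_add_line W e : subspace W -> closed W -> closed (add_line W e).
Proof.
move=> sW clW; apply/closed_nrm => x clx.
have [We|nWe] := pselect (W e).
  exists 0; rewrite scale0r subr0; move/closed_nrm: clW; apply.
  apply/closure_nrm => r r0; move/closure_nrm: clx => /(_ r r0)[z [c Wz] xz].
  exists z => //; rewrite -(subrK (c *: e) z).
  by apply: subspaceD => //; apply: subspaceZ.
have [r r0 er] : exists2 r, 0 < r & forall z, W z -> r <= nrm (e - z).
  by apply: far_from_closure => /(proj1 (closed_nrm _) clW).
have /choice[p pP] : forall n, exists p : X * R[i],
    W (p.1 - p.2 *: e) /\ nrm (x - p.1) < 1 / 2 ^+ n.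
  move=> n; move/closure_nrm: clx => /(_ (1 / 2 ^+ n)).
  by rewrite divr_gt0 ?exprn_gt0 // => /(_ isT)[z [c Wz] xz]; exists (z, c).
have cauchy_c : is_cauchy (fun n => (p n).2).
  move=> d d0; have dr0 : 0 < d * r / 2 by rewrite divr_gt0 ?mulr_gt0.
  have [N NP] := small_pow2 1 dr0; exists N => m n /NP Nm /NP Nn.
  have [Wm xm] := pP m; have [Wn xn] := pP n.
  rewrite -(ltr_pM2r r0).
  have := dist_line ((p m).2 - (p n).2) sW (ltW r0) er (subspaceB sW Wm Wn).
  have -> : ((p m).2 - (p n).2) *: e +
      ((p m).1 - (p m).2 *: e - ((p n).1 - (p n).2 *: e)) = (p m).1 - (p n).1.
    by rewrite scalerBl opprB addrACA [_ + (_ - _)]addrC subrK addKr.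
  have := nrm_split x (p m).1 (p n).1; rewrite (nrmC (p m).1 x); lra.
have [l cl] := cauchy_converges_complex cauchy_c.
exists l; move/closed_nrm: clW; apply; apply/closure_nrm => d d0.
have d2 : 0 < d / 2 by rewrite divr_gt0.
have e0 : 0 < nrm e.
  by apply: nrm_gt0 => e0; apply: nWe; rewrite e0; apply: subspace0.
have [N NP] := small_pow2 1 d2.
have [M MP] := cl _ (divr_gt0 d2 e0).
set n := maxn N M; have [Wn xn] := pP n; exists ((p n).1 - (p n).2 *: e) => //.
have -> : x - l *: e - ((p n).1 - (p n).2 *: e) =
    (x - (p n).1) + ((p n).2 - l) *: e.
  by rewrite scalerBl opprB [(p n).2 *: e - (p n).1]addrC addrACA [- (l *: e) + _]addrC.
have := nrmD (x - (p n).1) (((p n).2 - l) *: e); rewrite nrmZ.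
have := NP n (leq_maxl _ _); have := MP n (leq_maxr _ _).
rewrite ltr_pdivlMr //; move: xn; lra.
Qed.

Lemma closed_add_span W s : subspace W -> closed W -> closed (add_span W s).
Proof.
move=> sW clW; elim: s => //= e s; apply: closed_add_line.
exact: subspace_add_span.
Qed.

(** Total boundedness of the unit ball in the seminorm given by the distance to
    W, with a finite net that need not lie in the ball. *)
Definition totally_bounded_mod W : Prop := forall d : R, 0 < d ->
  exists s, forall x, nrm x <= 1 ->
    exists2 z, z \in s & exists2 y, W y & nrm (x - z - y) < d.

Lemma interval_net (L d : R) : 0 < d ->
  exists t : seq R, forall a, `|a| <= L -> exists2 b, b \in t & `|a - b| <= d.
Proof.
move=> d0; pose g (n : nat) : R := n%:R * d - L.
exists [seq g n | n <- iota 0 (Num.truncn (2 * L / d)).+1] => a.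
rewrite ler_norml => /andP[aL La].
have aL0 : 0 <= (a + L) / d by rewrite divr_ge0 ?(ltW d0) //; lra.
exists (g (Num.truncn ((a + L) / d))).
  apply: map_f; rewrite mem_iota /= add0n ltnS le_truncn // ler_pM2r ?invr_gt0 //.
  lra.
have /andP[] := truncn_itv aL0; rewrite ler_pdivlMr // ltr_pdivrMr // -natr1.
by rewrite /g ler_norml; set m := _%:R; lra.
Qed.

Lemma disc_net (L d : R) : 0 < d ->
  exists t : seq R[i], forall c, nrm c <= L -> exists2 b, b \in t & nrm (c - b) <= d.
Proof.
move=> d0; have [t tP] := interval_net L (divr_gt0 d0 (ltr0n _ 2)).
exists [seq a +i* b | a <- t, b <- t] => c cL; have [Hr Hi _] := nrm_ReIm c.
have [a at_ ca] := tP _ (le_trans Hr cL); have [b bt cb] := tP _ (le_trans Hi cL).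
exists (a +i* b); first exact: allpairs_f.
have [_ _] := nrm_ReIm (c - (a +i* b)).
by case: c {cL Hr Hi} ca cb => x y /=; lra.
Qed.

(** A point of the unit ball is near z + c e modulo W, with z from the net modulo
    W + Ce.  Either e is a limit of elements of W and c e can be neglected
    whatever the size of c, or e is at positive distance from W, which bounds c,
    and a net of the disc of possible coefficients finishes. *)
Lemma totally_bounded_line W e : subspace W ->
  totally_bounded_mod (add_line W e) -> totally_bounded_mod W.
Proof.
move=> sW tbe d d0; have d2 : 0 < d / 2 by rewrite divr_gt0.
have [s sP] := tbe _ d2.
have [We|/far_from_closure[r r0 er]] := pselect (closure W e).
  exists s => x /sP[z zs [y [c Wy] xzy]]; exists z => //.
  have c1 : 0 < nrm c + 1 by rewrite ltr_wpDl ?nrm_ge0.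
  move/closure_nrm: We => /(_ _ (divr_gt0 d2 c1))[w Ww ew].
  exists (y - c *: e + c *: w); first by apply: subspaceD => //; apply: subspaceZ.
  have -> : x - z - (y - c *: e + c *: w) = (x - z - y) + c *: (e - w).
    by rewrite scalerBr opprD opprB !addrA [_ + c *: e - y]addrAC.
  have := nrmD (x - z - y) (c *: (e - w)); rewrite nrmZ.
  move: ew; rewrite ltr_pdivlMr //; have := nrm_ge0 (e - w); lra.
have [b bP] : exists b, forall z, z \in s -> nrm z <= b.
  elim: s {sP} => [|z s [b bP]]; first by exists 0.
  exists (Num.max (nrm z) b) => y; rewrite in_cons le_max => /predU1P[->|/bP ->].
    by rewrite lexx.
  by rewrite orbT.
have e1 : 0 < nrm e + 1 by rewrite ltr_wpDl ?nrm_ge0.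
have de0 : 0 < d / 2 / (nrm e + 1) by rewrite divr_gt0.
have [t tP] := disc_net ((1 + b + d / 2) / r) de0.
exists [seq z + c *: e | z <- s, c <- t] => x x1.
have [z zs [y [c Wy] xzy]] := sP x x1.
have [c' c't cc'] : exists2 c', c' \in t & nrm (c - c') <= d / 2 / (nrm e + 1).
  apply: tP; rewrite ler_pdivlMr //.
  have := dist_line c sW (ltW r0) er Wy; rewrite addrC subrK => /le_trans; apply.
  have := nrm_split (x - z) y 0; rewrite !subr0 (nrmC y).
  have := nrmB x z; have := bP z zs; lra.
exists (z + c' *: e); first exact: allpairs_f.
exists (y - c *: e) => //.
have -> : x - (z + c' *: e) - (y - c *: e) = (x - z - y) + (c - c') *: e.
  rewrite scalerBl opprB opprD !addrA [LHS]addrAC [RHS]addrAC.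
  by congr (_ + _); rewrite addrAC.
have := nrmD (x - z - y) ((c - c') *: e); rewrite nrmZ.
move: cc'; rewrite ler_pdivlMr //; have := nrm_ge0 (c - c'); lra.
Qed.

Lemma totally_bounded_cofinite W s : subspace W ->
  (forall x, add_span W s x) -> totally_bounded_mod W.
Proof.
move=> sW full; have : totally_bounded_mod (add_span W s).
  move=> d d0; exists [:: 0] => x _; exists 0; first by rewrite mem_head.
  by exists x; rewrite ?subr0 ?subrr ?nrm0.
elim: s {full} => [//|e s IH] /totally_bounded_line tb.
by apply/IH/tb/subspace_add_span.
Qed.

(** Riesz: iterate the approximation on the error. *)
Lemma closed_half_full W : subspace W -> closed W ->
  (forall x, nrm x <= 1 -> exists2 w, W w & nrm (x - w) <= 1 / 2) ->
  forall x, W x.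
Proof.
move=> sW clW half x.
pose O : {linear X -> X} := \0.
have bO : bounded_operator O by exists 0 => y; rewrite normr0 mul0r.
have [|z _] := @successive_approximation _ _ O W setT 0 bO clW sW (lexx 0) _ x I.
  move=> y _; have [->|/eqP/nrm_gt0 y0] := eqVneq y 0.
    exists 0, 0; rewrite /= !subr0 nrm0 mulr0 mul0r; split => //.
    exact: subspace0.
  pose t : R[i] := (nrm y)%:C; have tN : nrm t = nrm y by rewrite nrm_real ?ltW.
  have t0 : t != 0 by apply/eqP => t0; move: tN y0; rewrite t0 nrm0 => <-; rewrite ltxx.
  have [|w Ww yw] := half (t^-1 *: y).
    by rewrite nrmZ nrmV tN mulVf // gt_eqF.
  exists 0, (y - t *: w); split=> //.
  - by rewrite nrm0 mul0r.
  - by rewrite /= subr0 subKr; apply: subspaceZ.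
  - rewrite -{1}(scalerKV t0 y) -scalerBr nrmZ tN.
    by have := ler_wpM2l (ltW y0) yw; lra.
by rewrite /= subr0.
Qed.

(** The unit ball is totally bounded modulo W.  Modulo V it is then within
    distance 1/2 of the finite set of net points: the part of a vector lying in
    W has norm at most 2 + 1/8, so the hypothesis moves it into V at the cost of
    17/64.  Adding the net points to V therefore gives the whole space. *)
Lemma cofinite_gap W V s : subspace W -> subspace V -> closed V ->
  (forall x, add_span W s x) ->
  (forall y, W y -> exists2 v, V v & nrm (y - v) <= nrm y / 8) ->
  exists t, forall x, add_span V t x.
Proof.
move=> sW sV clV full gap.
have [//|t tP] := totally_bounded_cofinite sW full (d := 1 / 16).
pose near z x := exists2 y, W y & nrm (x - z - y) < 1 / 16.
(* The net points are moved into the unit ball, which keeps the elements of W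
   that occur bounded. *)
have /choice[b bP] : forall z, exists b, forall x, nrm x <= 1 -> near z x ->
    nrm b <= 1 /\ near z b.
  move=> z; have [[b b1]|nb] := pselect (exists b, nrm b <= 1 /\ near z b).
    by exists b.
  by exists 0 => x x1 zx; case: nb; exists x.
exists (map b t); apply: closed_half_full.
- exact: subspace_add_span.
- exact: closed_add_span.
move=> x x1; have [z zt zx] := tP x x1.
have [b1 [y' Wy' zb]] := bP z x x1 zx; have [y Wy xzy] := zx.
have [v Vv yv] := gap _ (subspaceB sW Wy Wy').
have E : x - b z = (y - y') + ((x - z - y) - (b z - z - y')).
  by rewrite [- (b z - z - y')]opprB addrCA !addrA !subrK opprB addrA subrK.
exists (b z + v).
  apply: subspaceD; first exact: subspace_add_span.
    by apply: mem_add_span => //; apply: map_f.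
  exact: sub_add_span.
have F : x - (b z + v) = (y - y' - v) + ((x - z - y) - (b z - z - y')).
  by rewrite opprD addrA E addrAC.
have := nrmD (y - y' - v) ((x - z - y) - (b z - z - y')); rewrite -F.
have := nrmB (x - z - y) (b z - z - y').
have := nrmB (x - b z) ((x - z - y) - (b z - z - y')).
rewrite {1}E addrK; have := nrmB x (b z); lra.
Qed.

End FiniteCodimension.

(** * Powers and shifts of an operator *)

Section LinearInstances.
Context {R : realType} {X : normedModType R[i]}.

Lemma sub_scalar_linear (S : {linear X -> X}) (mu : R[i]) :
  linear (sub_scalar S mu).
Proof.
move=> a x y; rewrite /sub_scalar linearP scalerDr opprD addrACA scalerBr.
by rewrite !scalerA mulrC.
Qed.

HB.instance Definition _ (S : {linear X -> X}) (mu : R[i]) :=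
  GRing.isLinear.Build R[i] X X *:%R (sub_scalar S mu) (sub_scalar_linear S mu).

Lemma iter_linear (S : {linear X -> X}) n : linear (iter n S).
Proof. by move=> a x y; elim: n => //= n ->; rewrite linearP. Qed.

HB.instance Definition _ (S : {linear X -> X}) n :=
  GRing.isLinear.Build R[i] X X *:%R (iter n S) (iter_linear S n).

End LinearInstances.

Section Operators.
Context {R : realType} {X : completeNormedModType R[i]}.
Implicit Types (W V M N : set X) (S T f : {linear X -> X}) (s : seq X) (mu nu : R[i]).

Lemma sub_scalarE S mu x : sub_scalar S mu x = S x - mu *: x.
Proof. by []. Qed.

Lemma sub_scalar_shift T lam mu :
  sub_scalar T mu = sub_scalar (sub_scalar T lam) (mu - lam).
Proof.
by apply/funext => x; rewrite /sub_scalar scalerBl opprB addrA subrK.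
Qed.

Lemma bounded_of_nrm (f : X -> X) (m : R) :
  (forall x, nrm (f x) <= m * nrm x) -> bounded_operator f.
Proof. by move=> fm; exists m => x; rewrite !nrmE -rmorphM lecR. Qed.

Lemma bounded_sub_scalar (f : X -> X) mu :
  bounded_operator f -> bounded_operator (sub_scalar f mu).
Proof.
move=> /bounded_nrm[m _ fm]; apply: (@bounded_of_nrm _ (m + nrm mu)) => x.
apply: le_trans (nrmB _ _) _; rewrite nrmZ mulrDl.
by rewrite lerD2r.
Qed.

Lemma bounded_iter (f : X -> X) n : bounded_operator f -> bounded_operator (iter n f).
Proof.
move=> /bounded_nrm[m m0 fm]; apply: (@bounded_of_nrm _ (m ^+ n)) => x.
elim: n => [|n IH] /=; first by rewrite expr0 mul1r.
by apply: le_trans (fm _) _; rewrite exprS -mulrA ler_pM2l.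
Qed.

Lemma closed_null f : bounded_operator f -> closed (null_space f).
Proof.
move=> /bounded_nrm[m m0 fm]; apply/closed_nrm => x /closure_nrm clx.
apply: nrm_eq0; apply/eqP; rewrite eq_le nrm_ge0 andbT.
apply/ler_addgt0Pr => e e0; rewrite add0r.
have [z fz xz] := clx (e / m) (divr_gt0 e0 m0).
have := fm (x - z); rewrite linearB /= fz subr0.
by move: xz; rewrite ltr_pdivlMr // mulrC => /ltW /[swap] /le_trans; apply.
Qed.

Lemma subspace_null f : subspace (null_space f).
Proof.
split; rewrite /null_space /=.
- by rewrite linear0.
- by move=> x y fx fy; rewrite linearD fx fy addr0.
- by move=> c x fx; rewrite linearZ /= fx scaler0.
Qed.

Lemma subspace_range f : subspace (range f).
Proof.
split; first by exists 0; rewrite ?linear0.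
- by move=> _ _ [x _ <-] [y _ <-]; exists (x + y); rewrite ?linearD.
- by move=> c _ [x _ <-]; exists (c *: x); rewrite ?linearZ.
Qed.

Lemma subspace_range_pow S n : subspace (range_pow S n).
Proof. exact: subspace_range. Qed.

Lemma iterB S n : {morph iter n S : x y / x - y}.
Proof. by move=> x y; rewrite linearB. Qed.

Lemma range_pow_iter S n x : range_pow S n (iter n S x).
Proof. by exists x. Qed.

Lemma range_powD S n k x : range_pow S n x -> range_pow S (k + n) (iter k S x).
Proof. by move=> [y _ <-]; exists y; rewrite ?iterD. Qed.

Lemma range_pow_mono S m n : (m <= n)%N -> range_pow S n `<=` range_pow S m.
Proof.
move=> mn _ [x _ <-]; exists (iter (n - m) S x) => //.
by rewrite -iterD subnKC.
Qed.

Lemma add_span_map W f s x :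
  add_span W (map f s) (f x) <-> add_span (f @^-1` W) s x.
Proof.
elim: s x => [//|e s IH] x /=; split=> -[c Wx]; exists c.
  by apply/IH; rewrite linearB linearZ.
by move/IH: Wx; rewrite linearB linearZ.
Qed.

Lemma add_span_sub W V s : subspace V -> W `<=` V -> {in s, forall x, V x} ->
  add_span W s `<=` V.
Proof.
move=> sV WV; elim: s => [//|e s IH] Vs x [c /IH Vx].
rewrite -(subrK (c *: e) x); apply: subspaceD => //.
  by apply: Vx => y ys; apply: Vs; rewrite in_cons ys orbT.
by apply: subspaceZ => //; apply: Vs; rewrite mem_head.
Qed.

Lemma preimage_range_pow S n :
  iter n S @^-1` range_pow S n.+1 = add_range S (null_space (iter n S)).
Proof.
apply/seteqP; split=> x /= [y].
  by move=> _; rewrite iterSr => yx; exists y; rewrite /null_space /= linearB /= yx subrr.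
rewrite /null_space /= linearB /= => /subr0_eq yx.
by exists y => //; rewrite iterSr.
Qed.

(** Applying S^n identifies X / (R(S) + N(S^n)) with R(S^n) / R(S^(n+1)). *)
Lemma descent_codim_fin S n :
  (quotient_dim (range_pow S n) (range_pow S n.+1) < +oo)%E <->
  exists s, forall x, add_span (add_range S (null_space (iter n S))) s x.
Proof.
have sn := subspace_range_pow S n; have sn1 := subspace_range_pow S n.+1.
apply: iff_trans (quotient_dim_fin sn sn1) _; rewrite -preimage_range_pow; split.
  move=> [s sR RW].
  have [t st] : exists t, s = map (iter n S) t.
    elim: s sR {RW} => [|e s IH] sR; first by exists [::].
    have [|t ->] := IH; first by move=> x xs; apply: sR; rewrite in_cons xs orbT.
    by have [y _ <-] := sR e (mem_head _ _); exists (y :: t).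
  by exists t => x; apply/add_span_map; rewrite -st; apply: RW; apply: range_pow_iter.
move=> [s full]; exists (map (iter n S) s).
  by move=> _ /mapP[x _ ->]; apply: range_pow_iter.
by move=> _ [x _ <-]; apply/add_span_map.
Qed.

Lemma lower_semi_FredholmP f :
  lower_semi_Fredholm f <-> exists s, forall x, add_span (range f) s x.
Proof.
have sT : subspace [set: X] by split.
apply: iff_trans (quotient_dim_fin sT (subspace_range f)) _; split.
  by move=> [s _ full]; exists s => x; apply: full.
by move=> [s full]; exists s => // x _.
Qed.

Lemma Fredholm_Drazin f : lower_semi_Fredholm f -> right_essentially_Drazin f.
Proof.
move=> Ff; exists 0%N.
  apply: inf_nat0 => /=; suff -> : range_pow f 0 = setT by [].
  by apply/seteqP; split => // x _; exists x.
by suff -> : range_pow f 0 = setT by []; apply/seteqP; split => // x _; exists x.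
Qed.

Lemma Drazin_descent f : right_essentially_Drazin f ->
  (essential_descent f < +oo)%E.
Proof. by case=> n -> _; rewrite ltry. Qed.

(** Modulo the range of S - nu the operator S acts as the nonzero scalar nu, so a
    power of S cannot kill a nonzero class. *)
Lemma null_pow_shift S n nu : nu != 0 ->
  null_space (iter n S) `<=` range (sub_scalar S nu).
Proof.
move=> nu0; set B := sub_scalar S nu; have sB := subspace_range B.
have step x : range B (S x) -> range B x.
  move=> BSx; rewrite -(scalerK nu0 x); apply: subspaceZ => //.
  have -> : nu *: x = S x - B x by rewrite /B sub_scalarE subKr.
  by apply: subspaceB => //; exists x.
suff H x : range B (iter n S x) -> range B x.
  by move=> x xN; apply: H; rewrite xN; apply: subspace0.
by elim: n x => [//|n IH] x; rewrite iterSr => /IH /step.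
Qed.

(** On the kernel of a power of S - nu the operator S is invertible, being nu plus
    a nilpotent. *)
Lemma null_pow_shift_range S nu j n : nu != 0 ->
  null_space (iter j (sub_scalar S nu)) `<=` range_pow S n.
Proof.
move=> nu0; set B := sub_scalar S nu.
have step k x : (forall m, range_pow S m (B x)) -> range_pow S k x.
  move=> Bx; elim: k => [|k IH]; first by exists x.
  rewrite -(scalerK nu0 x); apply: subspaceZ; first exact: subspace_range_pow.
  have -> : nu *: x = S x - B x by rewrite /B sub_scalarE subKr.
  apply: subspaceB => //; first exact: subspace_range_pow.
  exact: (@range_powD S k 1).
move=> x; elim: j x n => [|j IH] x n.
  rewrite /null_space /= => ->. exact: subspace0 (subspace_range_pow S n).
rewrite /null_space [X in X -> _]/= -iterS iterSr => Bx; apply: step => m.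
exact: IH.
Qed.

(** * Perturbation *)

(** If S x = y modulo N, the error in (S - nu) x = y is nu x: when nu is small
    against the lifting constant it has at most half the norm of y, and the
    equation for S - nu is solved by iteration. *)
Lemma perturbed_range S N P (K : R) nu : bounded_operator S ->
  closed N -> subspace N -> 0 <= K -> nrm nu * K <= 1 / 2 ->
  (forall y, P y -> exists x, [/\ nrm x <= K * nrm y, N (y - S x) & P (nu *: x)]) ->
  P `<=` add_range (sub_scalar S nu) N.
Proof.
move=> bS clN sN K0 nuK lift y Py.
have bB := bounded_sub_scalar nu bS.
have [|x _ Nx] := successive_approximation bB clN sN K0 _ Py; last by exists x.
move=> {Py}y /lift[x [xy Nx Px]].
exists x, (nu *: x); split => //.
  by rewrite /= sub_scalarE opprB addrA addrAC addrK.
rewrite nrmZ; have := ler_wpM2l (nrm_ge0 nu) xy; rewrite mulrA.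
by have := ler_wpM2r (nrm_ge0 y) nuK; lra.
Qed.

(** With X = R(S) + W, where W = N(S^n) + span s is closed, the equality
    X = R(S - nu) + W persists for small nu, and then N(S^n) is absorbed by
    R(S - nu). *)
Lemma Fredholm_shift_of_descent S : bounded_operator S ->
  (essential_descent S < +oo)%E ->
  exists2 e : R, 0 < e &
    forall nu, nu != 0 -> nrm nu < e -> lower_semi_Fredholm (sub_scalar S nu).
Proof.
move=> bS /inf_nat_min[n /descent_codim_fin[s full] _].
set N := null_space (iter n S) in full; pose W := add_span N s.
have sN : subspace N := subspace_null (iter n S).
have sW : subspace W := subspace_add_span s sN.
have clW : closed W.
  by apply: closed_add_span => //; apply: closed_null; apply: bounded_iter.
have fullW x : add_range S W x by apply/add_range_span.
have clV : closed (add_range S W) by apply/closed_nrm => x _; apply: fullW.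
have [K K0 lift] := open_mapping bS clW sW clV.
have e0 : 0 < 1 / 2 / (K + 1) by rewrite !divr_gt0 // ltr_wpDl.
exists (1 / 2 / (K + 1)) => // nu nu0 nue; apply/lower_semi_FredholmP.
exists s => x.
have nuK : nrm nu * K <= 1 / 2.
  move: nue; rewrite ltr_pdivlMr ?ltr_wpDl //; have := nrm_ge0 nu; lra.
have [u] : add_range (sub_scalar S nu) W x.
  apply: (perturbed_range bS clW sW K0 nuK (P := setT)) => // y _.
  by have [u uy Wu] := lift y (fullW y); exists u.
move=> /(add_span_mono (null_pow_shift nu0)) Ru.
rewrite -(subrK (sub_scalar S nu u) x).
have sR := subspace_range (sub_scalar S nu).
apply: subspaceD => //; first exact: subspace_add_span.
by apply: sub_add_span; exists u.
Qed.

(** The preimage of R(S^(d+1)) under S^d is R(S) + N(S^d), and S^d does not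
    increase norms when its range carries the operator range norm. *)
Lemma tud_closed_add_range S d : topological_uniform_descent S d ->
  closed (add_range S (null_space (iter d S))).
Proof.
move=> tud; have [_ rc] := tud _ (leqnSn d); rewrite -preimage_range_pow.
apply/closed_nrm => x /closure_nrm clx; apply: rc; first exact: range_pow_iter.
move=> e /clx[z Rz xz]; exists (iter d S z) => //; apply: le_lt_trans xz.
apply: ge_inf; first by exists 0 => _ [y _ <-]; apply: nrm_ge0.
by exists (x - z) => //=; rewrite linearB.
Qed.

Lemma descent_defect0 S n : descent_defect S n = 0%E ->
  forall x, range_pow S n x -> S x = 0 -> range_pow S n.+1 x.
Proof.
by move=> /quotient_dim0 H x Rx Sx; have [] := H x (conj Rx Sx).
Qed.

(** By induction on n: as k_n vanishes, the kernel of S meets R(S^n) and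
    R(S^(n+1)) in the same subspace. *)
Lemma tud_null_range S d n : topological_uniform_descent S d ->
  forall x, range_pow S d x -> S x = 0 -> range_pow S n x.
Proof.
move=> tud x Rx Sx.
have H k : range_pow S (d + k) x.
  elim: k => [|k IH]; first by rewrite addn0.
  rewrite addnS; apply: descent_defect0 => //.
  by have [] := tud _ (leq_addr k d).
by apply: range_pow_mono (H n); exact: leq_addl.
Qed.

(** M plays in X / N the role of the hyper-range of a semiregular operator: the
    map induced by S sends M / N onto itself and has its kernel inside M / N. *)
Definition invariant_core S N M : Prop :=
  [/\ subspace M, N `<=` M, forall y, M y -> exists2 x, M x & N (y - S x)
    & forall x, N (S x) -> M x].

(** If S^d y is in every range then S^d y = S z with z in R(S^d), and z differs
    from an element of R(S^n) by an element of the kernel of S in R(S^d), which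
    lies in every range. *)
Lemma tud_core S d : topological_uniform_descent S d ->
  invariant_core S (null_space (iter d S))
    [set x | forall n, range_pow S n (iter d S x)].
Proof.
move=> tud; split => /=.
- split=> /=.
  + by move=> n; rewrite linear0; apply: subspace0 (subspace_range_pow S n).
  + move=> x y Mx My n; rewrite linearD.
    by apply: subspaceD => //; apply: subspace_range_pow.
  + move=> c x Mx n; rewrite linearZ.
    by apply: subspaceZ => //; apply: subspace_range_pow.
- by move=> x /= -> n; apply: subspace0 (subspace_range_pow S n).
- move=> y My; have [x _ xy] := My d.+1.
  have xE : S (iter d S x) = iter d S y by rewrite -xy.
  exists x; last first.
    by rewrite /null_space /= linearB /= -iterSr /= xE subrr.
  move=> n; apply: (@range_pow_mono S n (n + d)); first exact: leq_addr.
  have [z _ zy] := My (n + d).+1.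
  rewrite -(subrK (iter (n + d) S z) (iter d S x)).
  have sR := subspace_range_pow S (n + d).
  apply: subspaceD => //; last exact: range_pow_iter.
  apply: (tud_null_range _ tud).
    apply: subspaceB; first exact: subspace_range_pow.
      exact: range_pow_iter.
    by apply: range_pow_mono (range_pow_iter S (n + d) z); exact: leq_addl.
  by rewrite linearB xE -[S (iter _ _ z)]/(iter (n + d).+1 S z) zy subrr.
- move=> x; rewrite /null_space /= -iterSr => Sx n.
  exact: (tud_null_range _ tud (range_pow_iter S d x)).
Qed.

Section Core.
Context (S : {linear X -> X}) (N M : set X) (K : R).
Context (bS : bounded_operator S) (clN : closed N) (sN : subspace N).
Context (core : invariant_core S N M) (K0 : 0 < K).
Context (lift : forall y, add_range S N y ->
  exists2 x, nrm x <= K * nrm y & N (y - S x)).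

Lemma core_sub_add_range : M `<=` add_range S N.
Proof. by case: core => _ _ MS _ y /MS[x _ Nx]; exists x. Qed.

(** A controlled lift x of y in M stays in M, since it differs from a lift in M by
    an element that S sends into N; hence the error nu x stays in M as well. *)
Lemma core_perturbed nu : nrm nu * K <= 1 / 2 ->
  M `<=` add_range (sub_scalar S nu) N.
Proof.
move=> nuK; case: core => sM NM MS MN.
apply: (perturbed_range bS clN sN (ltW K0) nuK) => y My.
have [x xy Nx] := lift (core_sub_add_range My); exists x; split => //.
have [x' Mx' Nx'] := MS y My.
apply: subspaceZ => //; rewrite -(subrK x' x); apply: subspaceD => //.
apply: MN; have -> : S (x - x') = (y - S x') - (y - S x).
  by rewrite [S _]linearB opprB [RHS]addrC addrA subrK.
exact: subspaceB.
Qed.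

(** S is bounded below modulo M: lift S x - m to a small u; then S maps x - u into
    M, so x - u itself is in M. *)
Lemma core_distance x m : M m -> exists2 m', M m' & nrm (x - m') <= K * nrm (S x - m).
Proof.
move=> Mm; case: core => sM NM MS MN.
have sV := subspace_add_range S sN.
have VSx : add_range S N (S x - m).
  apply: subspaceB => //; last exact: core_sub_add_range.
  by exists x; rewrite subrr; apply: subspace0.
have [u ux Nu] := lift VSx; exists (x - u); last by rewrite subKr.
have [m' Mm' Nm'] := MS m Mm.
rewrite -(subrK m' (x - u)); apply: subspaceD => //; apply: MN.
have -> : S (x - u - m') = (S x - m - S u) + (m - S m').
  by rewrite !linearB /= addrA [_ - S u + m]addrAC subrK.
exact: subspaceD.
Qed.

(** Let y = (S - nu) x modulo N.  Since S is bounded below modulo M and nu is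
    small, x is within 3 K |y| of some m in M.  Then y + nu (x - m), which is
    S x - nu m modulo N, lies in R(S) + N and is close to y. *)
Lemma core_gap nu : nrm nu * K <= 1 / 24 ->
  forall y, add_range (sub_scalar S nu) N y ->
    exists2 v, add_range S N v & nrm (y - v) <= nrm y / 8.
Proof.
move=> nuK y [x Ny]; case: core => sM NM MS MN.
have sV := subspace_add_range S sN.
have [->|/eqP/nrm_gt0 y0] := eqVneq y 0.
  by exists 0; [exact: subspace0|rewrite subr0 nrm0 mul0r].
(* Each use of the lower bound for S halves the excess over 2 K |y| of the bound
   on the distance from x to M. *)
have approx j : exists2 m, M m & nrm (x - m) <= nrm x / 2 ^+ j + 2 * (K * nrm y).
  elim: j => [|j [m Mm xm]].
    exists 0; first exact: subspace0.
    by rewrite subr0 expr0 divr1 lerDl !mulr_ge0 ?ltW.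
  have [|m' Mm' xm'] := @core_distance x (nu *: m - (y - sub_scalar S nu x)).
    by apply: subspaceB => //; [exact: subspaceZ|exact: NM].
  exists m' => //; apply: le_trans xm' _.
  have -> : S x - (nu *: m - (y - sub_scalar S nu x)) = y + nu *: (x - m).
    by rewrite sub_scalarE scalerBr !opprB [LHS]addrC addrAC !addrA subrK.
  have := ler_wpM2l (ltW K0) (nrmD y (nu *: (x - m))); rewrite nrmZ.
  have := ler_wpM2r (nrm_ge0 (x - m)) nuK.
  rewrite exprSr invfM (mulrA (nrm x)); move: xm; set a := nrm x / 2 ^+ j.
  have := nrm_ge0 (x - m); lra.
have Ky : 0 < K * nrm y by rewrite mulr_gt0.
have [j jP] := small_pow2 (nrm x) Ky.
have [m Mm xm] := approx j; exists (y + nu *: (x - m)).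
  have -> : y + nu *: (x - m) = (y - sub_scalar S nu x) + S x - nu *: m.
    by rewrite sub_scalarE scalerBr opprB !addrA subrK.
  apply: subspaceB => //; last by apply: subspaceZ => //; apply: core_sub_add_range.
  apply: subspaceD => //; last by exists x; rewrite subrr; apply: subspace0.
  by apply: core_sub_add_range; apply: NM.
rewrite opprD addrA subrr add0r nrmN nrmZ.
have xm3 : nrm (x - m) <= 3 * (K * nrm y) by have := jP j (leqnn j); lra.
have := ler_wpM2l (nrm_ge0 nu) xm3.
have := ler_wpM2r (nrm_ge0 y) nuK; lra.
Qed.

End Core.

(** The kernels of the powers of S - nu lie in M, hence in R(S - nu) + N for small
    nu; finite essential descent of S - nu then gives R(S - nu) + N finite
    codimension, which passes to R(S) + N through the gap estimate. *)
Lemma essential_descent_of_shift S d : bounded_operator S ->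
  topological_uniform_descent S d ->
  exists2 e : R, 0 < e & forall nu, nu != 0 -> nrm nu < e ->
    (essential_descent (sub_scalar S nu) < +oo)%E -> (essential_descent S < +oo)%E.
Proof.
move=> bS tud; set N := null_space (iter d S).
have sN : subspace N := subspace_null (iter d S).
have clN : closed N by apply: closed_null; apply: bounded_iter.
have clV := tud_closed_add_range tud.
have core := tud_core tud; set M := [set x | _] in core.
have [K0 K0_ge0 lift0] := open_mapping bS clN sN clV.
(* The lifting constant is enlarged to be positive, for use as a divisor. *)
pose K := K0 + 1; have K_gt0 : 0 < K by rewrite ltr_wpDl.
have lift y : add_range S N y -> exists2 x, nrm x <= K * nrm y & N (y - S x).
  move=> /lift0[x xy Nx]; exists x => //; apply: le_trans xy _.
  by rewrite ler_wpM2r ?nrm_ge0 // lerDl.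
exists (1 / 24 / K); first by rewrite !divr_gt0.
move=> nu nu0; rewrite ltr_pdivlMr // => /ltW nuK.
have nuK2 : nrm nu * K <= 1 / 2 by lra.
move=> /inf_nat_min[j /descent_codim_fin[s full] _].
have MB := core_perturbed bS clN sN core K_gt0 lift nuK2.
have sub : add_range (sub_scalar S nu) (null_space (iter j (sub_scalar S nu)))
    `<=` add_range (sub_scalar S nu) N.
  move=> x [u Nu]; rewrite -(subrK (sub_scalar S nu u) x).
  apply: subspaceD; first exact: subspace_add_range.
    apply: MB => n; apply: range_pow_mono (leq_addl d n) _ _.
    by apply: range_powD; apply: null_pow_shift_range Nu.
  by exists u; rewrite subrr; apply: subspace0.
have [|t fullV] := cofinite_gap (subspace_add_range (sub_scalar S nu) sN)
    (subspace_add_range S sN) clV (fun x => add_span_mono sub (full x)).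
  by move=> y; have := core_gap sN core K_gt0 lift nuK (y := y).
by apply: (@inf_nat_fin _ _ d); apply/descent_codim_fin; exists t.
Qed.

(** * Closed ranges of powers *)

(** Let y = S^(n+1) x be a limit of elements of R(S^(n+2)).  By the open mapping
    theorem these are S^(n+1) (x - h) with h small, and the vanishing of k_n puts
    S^n (x - h) in the closed subspace R(S^(n+1)).  Hence S^n x is in it too. *)
Lemma closed_range_pow_succ S n : bounded_operator S ->
  descent_defect S n = 0%E -> closed (range_pow S n.+1) ->
  closed (range_pow S n.+2).
Proof.
(* The kernel of the identity stands for the zero subspace. *)
move=> bS dn clR; have clz : closed (null_space (idfun : {linear X -> X})).
  by apply: closed_null; exists 1 => x; rewrite mul1r.
have fE x : add_range (iter n.+1 S) (null_space (idfun : {linear X -> X})) x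
    <-> range_pow S n.+1 x.
  rewrite /add_range /null_space /=; split=> [[y /subr0_eq ->]|[y _ <-]].
    exact: range_pow_iter S n.+1 y.
  by exists y; rewrite subrr.
have cl : closed (add_range (iter n.+1 S) (null_space (idfun : {linear X -> X}))).
  by rewrite (_ : add_range _ _ = range_pow S n.+1) //; apply/funext => x; apply/propext.
have [K K0 lift] := open_mapping (bounded_iter n.+1 bS) clz (subspace_null _) cl.
apply/closed_nrm => y /closure_nrm cly.
have [x _ xy] : range_pow S n.+1 y.
  move/closed_nrm: clR; apply; apply/closure_nrm => e /cly[z Rz yz].
  by exists z => //; apply: range_pow_mono Rz.
suff [v _ vx] : range_pow S n.+1 (iter n S x).
  by exists v => //; rewrite -xy; exact: (congr1 S vx).
move/closed_nrm: clR; apply; apply/closure_nrm => e e0.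
have [m m0 Sm] := bounded_nrm (bounded_iter n bS).
have K1 : 0 < K + 1 by rewrite ltr_wpDl.
have [|z [u _ uz] yz] := cly (e / m / (K + 1)); first by rewrite !divr_gt0.
have [|h hyz /subr0_eq hE] := lift (y - z).
  by apply/fE; exists (x - S u) => //; rewrite iterB xy -iterSr uz.
exists (iter n S (x - h)); last first.
  rewrite -iterB opprB addrC subrK; apply: le_lt_trans (Sm _) _.
  rewrite mulrC -ltr_pdivlMr //; apply: le_lt_trans hyz _.
  move: yz; rewrite ltr_pdivlMr //; have := nrm_ge0 (y - z); lra.
rewrite -(subrK (iter n.+1 S u) (iter n S (x - h))).
have sR := subspace_range_pow S n.+1.
apply: subspaceD => //; last exact: range_pow_iter S n.+1 u.
apply: (descent_defect0 dn).
  apply: subspaceB; first exact: subspace_range_pow.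
    exact: range_pow_iter.
  by rewrite iterSr; apply: range_pow_iter.
rewrite linearB -[S (iter n S _)]/(iter n.+1 S _) iterB xy -hE subKr.
by rewrite -uz subrr.
Qed.

Lemma quasi_Fredholm_closed S : bounded_operator S -> quasi_Fredholm S ->
  exists m, forall n, (m < n)%N -> closed (range_pow S n).
Proof.
move=> bS [m km clm]; exists m => n; elim: n => [//|n IH].
rewrite ltnS leq_eqVlt => /predU1P[<- //|mn].
case: n mn IH => [//|n] mn IH; apply: closed_range_pow_succ => //.
  exact: km.
exact: IH.
Qed.

(** S^k carries finitely many generators of R(S^p) modulo R(S^(p+1)) to generators
    of R(S^(k+p)) modulo R(S^(k+p+1)). *)
Lemma descent_steps S p k : (quotient_dim (range_pow S p) (range_pow S p.+1) < +oo)%E ->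
  exists2 s, {in s, forall x, range_pow S p x} &
    range_pow S p `<=` add_span (range_pow S (k + p)) s.
Proof.
move=> /quotient_dim_fin[||s0 s0R step]; [exact: subspace_range_pow..|].
elim: k => [|k [s sR IH]]; first by exists [::].
exists (s ++ map (iter k S) s0).
  move=> x; rewrite mem_cat => /orP[/sR //|/mapP[y /s0R Ry ->]].
  by apply: range_pow_mono (leq_addl k p) _ _; apply: range_powD.
move=> x /IH; rewrite /add_span foldr_cat; apply: add_span_mono => {x}x [y _ <-].
rewrite iterD; apply/add_span_map.
apply: add_span_mono (step _ (range_pow_iter S p y)) => z Rz.
by rewrite addSnnS; apply: range_powD.
Qed.

(** With p the essential descent, R(S^p) is a finite-dimensional extension of
    R(S^(m+1+p)), a closed range. *)
Lemma quasi_Fredholm_descent_Drazin S : bounded_operator S -> quasi_Fredholm S ->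
  (essential_descent S < +oo)%E -> right_essentially_Drazin S.
Proof.
move=> bS /(quasi_Fredholm_closed bS)[m clm] /inf_nat_min[p fin pE].
exists p => //; have [s sR sub] := descent_steps m.+1 fin.
rewrite (_ : range_pow S p = add_span (range_pow S (m.+1 + p)) s).
  apply: closed_add_span; first exact: subspace_range_pow.
  by apply: clm; rewrite addSn ltnS leq_addr.
apply/seteqP; split => //; apply: add_span_sub => //.
  exact: subspace_range_pow.
by apply: range_pow_mono; exact: leq_addl.
Qed.

End Operators.

(** * Interior and accumulation points *)

Section PlaneSets.
Context {R : realType}.
Implicit Types (A B : set R[i]^o) (p : R[i]^o).

Lemma interior_limit_point A p : interior A p -> limit_point A p.
Proof.
move=> Ap U pU; have /nbhs_nrm[e e0 eA] : nbhs p (A `&` U) by exact: filterI.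
have e2 : 0 < e / 2 by rewrite divr_gt0.
have dE : nrm ((e / 2)%:C : R[i]^o) = e / 2 := nrm_real (ltW e2).
have [|Ay Uy] := eA (p + (e / 2)%:C).
  by rewrite opprD addrA subrr add0r nrmN dE; lra.
exists (p + (e / 2)%:C); split => //; rewrite -subr_eq0 addrAC subrr add0r.
by apply/eqP => d0; move: dE e2; rewrite d0 nrm0 => <-; rewrite ltxx.
Qed.

Lemma limit_point_mono A B p : A `<=` B -> limit_point A p -> limit_point B p.
Proof. by move=> AB Ap U /Ap[y [yp Ay Uy]]; exists y; split => //; exact: AB. Qed.

End PlaneSets.

(** * The equivalences *)

Theorem theorem2p11 (R : realType) (X : completeNormedModType R[i])
    (infX : infinite_dimensional X)
    (lambda : R[i]) (T : {linear X -> X}) (bT : bounded_operator T) (d : nat)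
    (tudT : topological_uniform_descent (sub_scalar T lambda) d) :
  [<-> ~ limit_point (spectrum_lower_semi_Fredholm T) lambda;
       ~ interior (spectrum_lower_semi_Fredholm T) lambda;
       ~ limit_point (spectrum_right_essentially_Drazin T) lambda;
       ~ interior (spectrum_right_essentially_Drazin T) lambda;
       ~ limit_point (spectrum_essential_descent T) lambda;
       ~ interior (spectrum_essential_descent T) lambda;
       (essential_descent (sub_scalar T lambda) < +oo)%E]
  /\
  (quasi_Fredholm (sub_scalar T lambda) ->
   [<-> ~ limit_point (spectrum_lower_semi_Fredholm T) lambda;
        ~ interior (spectrum_lower_semi_Fredholm T) lambda;
        ~ limit_point (spectrum_right_essentially_Drazin T) lambda;
        ~ interior (spectrum_right_essentially_Drazin T) lambda;
        ~ limit_point (spectrum_essential_descent T) lambda;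
        ~ interior (spectrum_essential_descent T) lambda;
        (essential_descent (sub_scalar T lambda) < +oo)%E;
        right_essentially_Drazin (sub_scalar T lambda)]).
Proof.
pose S : {linear X -> X} := sub_scalar T lambda.
have bS : bounded_operator S := bounded_sub_scalar lambda bT.
set F := spectrum_lower_semi_Fredholm T.
set D := spectrum_right_essentially_Drazin T.
set E := spectrum_essential_descent T.
have DF : D `<=` F by move=> mu nD /Fredholm_Drazin.
have ED : E `<=` D by move=> mu Emu /Drazin_descent; rewrite Emu ltxx.
have descent_F : (essential_descent S < +oo)%E -> ~ limit_point F lambda.
  move=> /(Fredholm_shift_of_descent bS)[e e0 Fr].
  have ball_e : nbhs (lambda : R[i]^o) [set mu | nrm (lambda - mu) < e].
    by apply/nbhs_nrm; exists e.
  move=> /(_ _ ball_e)[mu [mul Fmu mue]]; apply: Fmu.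
  rewrite (sub_scalar_shift T lambda); apply: Fr; first by rewrite subr_eq0.
  by rewrite nrmC.
have E_descent : ~ interior E lambda -> (essential_descent S < +oo)%E.
  move=> nE; rewrite ltey; apply/eqP => Soo; apply: nE.
  have [e e0 Sh] := essential_descent_of_shift bS tudT.
  apply/nbhs_nrm; exists e => // mu mue; have [->//|mul] := eqVneq mu lambda.
  rewrite /E /spectrum_essential_descent /= (sub_scalar_shift T lambda).
  apply: contrapT => /eqP; rewrite -ltey => fin.
  have := Sh (mu - lambda); rewrite subr_eq0 nrmC => /(_ mul mue fin).
  by rewrite Soo ltxx.
have lim_int (A : set R[i]^o) : ~ limit_point A lambda -> ~ interior A lambda.
  by move=> nA /interior_limit_point.
have lim_mono (A B : set R[i]^o) : A `<=` B -> ~ limit_point B lambda -> ~ limit_point A lambda.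
  by move=> AB nB /(limit_point_mono AB).
have int_mono (A B : set R[i]^o) : A `<=` B -> ~ interior B lambda -> ~ interior A lambda.
  by move=> AB nB /(interiorS AB).
have F_D : ~ interior F lambda -> ~ limit_point D lambda.
  by move=> /(int_mono _ _ DF)/(int_mono _ _ ED)/E_descent/descent_F/(lim_mono _ _ DF).
have D_E : ~ interior D lambda -> ~ limit_point E lambda.
  move=> /(int_mono _ _ ED)/E_descent/descent_F.
  by move=> /(lim_mono _ _ DF)/(lim_mono _ _ ED).
split; first by tfae=> //; exact: lim_int.
move=> qS; tfae=> //; try exact: lim_int.
  exact: quasi_Fredholm_descent_Drazin.
by move=> /Drazin_descent/descent_F.
Qed.
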